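(* Let $E$ be a real field, i.e. a field that admits a field ordering. Then any square-reflexive polynomial in $E[X]$ has at most three roots in $E$.
   Context: For a commutative ring $R$ let $R^\times$ be its group of units and $R^{\times 2}=\{x^2\mid x\in R^\times\}$; an element of $R$ is square-free if it is not equal to $x^2y$ for any $x\in R\setminus R^\times$ and $y\in R$. For a nonzero $f\in E[X]$ put $E_f=E[X]/(f)$, let $\mathrm{N}_{E_f/E}:E_f\to E$ be the norm of this finite-dimensional $E$-algebra and let $\mathrm{lc}(f)$ be the leading coefficient of $f$. A square-free polynomial $f\in E[X]\setminus\{0\}$ is called square-reflexive if for every $\alpha\in E_f^\times$ with $\mathrm{N}_{E_f/E}(\alpha)\in E^{\times 2}\cup \mathrm{lc}(f)E^{\times 2}$ there exists a polynomial $g\in E[X]$ coprime to $f$ such that $g+(f)\in\alpha E_f^{\times 2}$ and $f+(g)\in E_g^{\times 2}$. *)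

(* Defs.v *)
From HB Require Import structures.
From mathcomp Require Import all_boot all_algebra.
From mathcomp Require Import qpoly.

Set Implicit Arguments.
Unset Strict Implicit.
Unset Printing Implicit Defensive.

Import GRing.Theory.
Local Open Scope ring_scope.

Section CommutativeRing.
Variable R : comPzRingType.

(* The quotient ring E[X]/(f) below is trivial when f is constant, so
   [GRing.unit], which requires a nontrivial ring, is not available. *)
Definition is_unit (x : R) : Prop := exists y : R, x * y = 1.

Definition unit_square (x : R) : Prop := exists2 u : R, is_unit u & x = u ^+ 2.

(* x lies in a R^{x2}. *)
Definition in_square_class (a x : R) : Prop :=
  exists2 s : R, unit_square s & x = a * s.

Definition square_free (a : R) : Prop :=
  forall x y : R, ~ is_unit x -> a <> x ^+ 2 * y.

End CommutativeRing.

(* E[X]/(f) for f != 0, realized on the polynomials of degree < deg f (the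
   library type {poly %/ f} replaces f by 'X unless f is monic and
   nonconstant). For f = 0 it is the zero ring instead of E[X]. *)
Definition polymod (E : fieldType) (f : {poly E}) : Type :=
  {poly_(size f).-1 E}.

Section PolyMod.
Variables (E : fieldType) (f : {poly E}).

HB.instance Definition _ := Vector.copy (polymod f) {poly_(size f).-1 E}.

(* The coset p + (f). *)
Definition polymod_class (p : {poly E}) : polymod f :=
  npolyp (size f).-1 (p %% f).

Definition polymod_repr (x : polymod f) : {poly E} := polyn x.

Lemma polymod_inj : injective polymod_repr.
Proof. exact: val_inj. Qed.

Lemma polymod_reprD x y :
  polymod_repr (x + y) = polymod_repr x + polymod_repr y.
Proof. by []. Qed.

Lemma polymod_reprZ c x : polymod_repr (c *: x) = c *: polymod_repr x.
Proof. by []. Qed.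

Lemma polymod_classK p : f != 0 -> polymod_repr (polymod_class p) = p %% f.
Proof.
move=> f0; apply: npolypK.
by rewrite -ltnS prednK ?size_poly_gt0 // ltn_modp.
Qed.

Lemma polymod_triv (x y : polymod f) : f = 0 -> x = y.
Proof.
move=> f0; have repr0 z : polymod_repr z = 0.
  by apply/eqP; rewrite -size_poly_leq0 (leq_trans (size_npoly z)) // f0 size_poly0.
by apply: polymod_inj; rewrite !repr0.
Qed.

Lemma polymod_repr_modp x : f != 0 -> polymod_repr x %% f = polymod_repr x.
Proof.
move=> f0; rewrite modp_small // (leq_ltn_trans (size_npoly x)) // ltn_predL.
by rewrite size_poly_gt0.
Qed.

Lemma polymod_reprK : cancel polymod_repr polymod_class.
Proof.
move=> x; have [f0|f0] := eqVneq f 0; first exact: polymod_triv.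
by apply: polymod_inj; rewrite polymod_classK // polymod_repr_modp.
Qed.

Lemma polymod_class_eq p q : f != 0 ->
  (polymod_class p = polymod_class q) <-> (f %| p - q).
Proof.
move=> f0; rewrite /dvdp modpD modpN subr_eq0; split=> [e|/eqP e].
  by rewrite -!polymod_classK // e.
by apply: polymod_inj; rewrite !polymod_classK.
Qed.

Definition polymod_mul (x y : polymod f) : polymod f :=
  polymod_class (polymod_repr x * polymod_repr y).

Lemma polymod_mulA : associative polymod_mul.
Proof.
move=> x y z; have [f0|f0] := eqVneq f 0; first exact: polymod_triv.
apply: polymod_inj; rewrite !polymod_classK // modp_mul mulrA.
by rewrite [X in _ = X %% _]mulrC modp_mul mulrC.
Qed.

Lemma polymod_mulC : commutative polymod_mul.
Proof. by move=> x y; rewrite /polymod_mul mulrC. Qed.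

Lemma polymod_mul1 : left_id (polymod_class 1) polymod_mul.
Proof.
move=> x; have [f0|f0] := eqVneq f 0; first exact: polymod_triv.
apply: polymod_inj; rewrite !polymod_classK // mulrC modp_mul mulr1.
exact: polymod_repr_modp.
Qed.

Lemma polymod_mulDl : left_distributive polymod_mul +%R.
Proof.
move=> x y z; have [f0|f0] := eqVneq f 0; first exact: polymod_triv.
apply: polymod_inj; rewrite polymod_reprD !polymod_classK //.
by rewrite polymod_reprD mulrDl modpD.
Qed.

HB.instance Definition _ := GRing.Zmodule_isComPzRing.Build (polymod f)
  polymod_mulA polymod_mulC polymod_mul1 polymod_mulDl.

Lemma polymod_class_is_linear : linear polymod_class.
Proof.
move=> a p q; have [f0|f0] := eqVneq f 0; first exact: polymod_triv.
apply: polymod_inj; rewrite polymod_reprD polymod_reprZ !polymod_classK //.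
by rewrite modpD modpZl.
Qed.

HB.instance Definition _ := GRing.isLinear.Build E {poly E} (polymod f) _
  polymod_class polymod_class_is_linear.

Lemma polymod_class_is_monoid_morphism : monoid_morphism polymod_class.
Proof.
split=> // p q; have [f0|f0] := eqVneq f 0; first exact: polymod_triv.
apply: polymod_inj; rewrite !polymod_classK // modp_mul.
by rewrite [in RHS]mulrC modp_mul mulrC.
Qed.

HB.instance Definition _ := GRing.isMonoidMorphism.Build {poly E} (polymod f)
  polymod_class polymod_class_is_monoid_morphism.

Lemma polymod_scalerAr (c : E) (x y : polymod f) : x * (c *: y) = c *: (x * y).
Proof.
have [f0|f0] := eqVneq f 0; first exact: polymod_triv.
apply: polymod_inj; rewrite polymod_reprZ !polymod_classK //.
by rewrite polymod_reprZ -scalerAr modpZl.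
Qed.

(* The classes of 1, 'X, ..., 'X^(deg f - 1). *)
Definition polymod_basis : (size f).-1.-tuple (polymod f) :=
  npolyX E (size f).-1.

Lemma polymod_basisP : basis_of fullv polymod_basis.
Proof. exact: npolyX_full. Qed.

Lemma polymod_basisE (i : 'I_(size f).-1) :
  tnth polymod_basis i = polymod_class 'X^i.
Proof.
have f0 : f != 0.
  by rewrite -size_poly_gt0; case: (size f) i => [[]|].
have lti : (i.+1 < size f)%N by rewrite -ltn_predRL.
apply: polymod_inj; rewrite polymod_classK // modp_small ?size_polyXn //.
exact: npolyXE.
Qed.

(* The determinant of multiplication by x. *)
Definition polymod_norm (x : polymod f) : E :=
  \det (\matrix_(i, j) coord polymod_basis j (x * tnth polymod_basis i)).

End PolyMod.

Definition square_reflexive (E : fieldType) (f : {poly E}) : Prop :=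
  [/\ f != 0,
      square_free f
    & forall a : polymod f, is_unit a ->
        unit_square (polymod_norm a) \/
        in_square_class (lead_coef f) (polymod_norm a) ->
      exists g : {poly E},
        [/\ g != 0,
            coprimep g f,
            in_square_class a (polymod_class f g)
          & unit_square (polymod_class g f)]].

Definition field_ordering (E : fieldType) (le : E -> E -> Prop) : Prop :=
  [/\ forall x y, le x y -> le y x -> x = y,
      forall x y z, le x y -> le y z -> le x z,
      forall x y, le x y \/ le y x,
      forall x y z, le x y -> le (x + z) (y + z)
    & forall x y, le 0 x -> le 0 y -> le 0 (x * y)].

Definition real_field (E : fieldType) : Prop :=
  exists le : E -> E -> Prop, field_ordering le.

(* Main.v *)
Require Import Defs.
From HB Require Import structures.
From mathcomp Require Import all_boot all_algebra qpoly ring zify.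

Import GRing.Theory.
Local Open Scope ring_scope.

Set Implicit Arguments.
Unset Strict Implicit.

(** Suppose that [f] has four distinct roots in E, let [l] be the product of the
    corresponding factors 'X - x, and write f = l h. Square-freeness makes [h]
    nonzero at these roots. The class of

      alpha = l + l' h

    is a unit modulo [f]: it is l'(x) h(x) at a root x of [l], and [l] modulo
    [h]. Its norm is a square: the product of the l'(x) is a discriminant,
    and the factors h(x) occur once more, up to a fourth power, in the norm of
    [l] modulo [h] ([mod_norm_unit_square]). In the ordering of E the values
    l'(x) alternate in sign along the roots; this is what obstructs reflexivity.

    Indeed, assume g = alpha s^2 modulo [f] and f = u^2 modulo [g]
    ([no_mutually_square_pair]). Counting coefficients as in Thue's lemma
    ([small_solution]) gives polynomials v, t, z of small degree, not all zero,
    with v = u z modulo [g] and v = s l t modulo [h]. Then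

      v^2 - g l t^2 - f z^2 = g h q   with deg q <= 2,

    and at a root x of [l] this reads v(x)^2 = g(x) h(x) q(x). Since
    g(x) = l'(x) h(x) s(x)^2, the number q(x) / l'(x) is a square; but the sum
    of the q(x) / l'(x) is 0 by Lagrange interpolation
    ([sum_horner_div_deriv]). As E is real, every v(x) vanishes; so q, of degree
    at most 2 with four roots, vanishes too, [l] divides v, and with v = l w

      l w^2 = g t^2 + h z^2.

    The sum of the 1 / l'(x) is also 0, so l'(x) is positive at some root x.
    There g(x) h(x) is a nonzero square times l'(x), the form with coefficients
    g(x) and h(x) is definite, and infinite descent at 'X - x shows t = z = 0
    ([anisotropic_descent]), hence v = 0: a contradiction. *)

(** * Norms of quotients of polynomial rings *)

(** The dimension is a parameter rather than the degree of [f], so that for a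
    product [f] it can be written as the sum of the degrees of the factors. *)
Definition mulmod_mx {E : fieldType} n (f p : {poly E}) : 'M[E]_n :=
  \matrix_(i, j) (('X^i * p) %% f)`_j.

Definition mod_norm {E : fieldType} (f p : {poly E}) : E :=
  \det (mulmod_mx (size f).-1 f p).

Lemma polymod_norm_class (E : fieldType) (f p : {poly E}) : f != 0 ->
  polymod_norm (polymod_class f p) = mod_norm f p.
Proof.
move=> f0; congr (\det _); apply/matrixP=> i j; rewrite !mxE.
rewrite polymod_basisE -rmorphM.
transitivity (polymod_repr (polymod_class f (p * 'X^i)))`_j.
  exact: npolyX_coords.
by rewrite polymod_classK // mulrC.
Qed.

Lemma rVpolyE (R : nzSemiRingType) n (v : 'rV[R]_n) :
  rVpoly v = \sum_(i < n) v 0 i *: 'X^i.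
Proof. by rewrite /rVpoly poly_def; apply: eq_bigr => i _; rewrite valK. Qed.

Lemma size_rVpoly (R : nzSemiRingType) n (v : 'rV[R]_n) :
  (size (rVpoly v) <= n)%N.
Proof. exact: size_poly. Qed.

(** On row vectors of coefficients the matrix acts as multiplication by [p]
    modulo [f]; every identity between norms below reduces to an identity
    between remainders through this. *)
Lemma rVpoly_mulmod (E : fieldType) n (f p : {poly E}) (v : 'rV_n) :
  size f = n.+1 ->
  rVpoly (v *m mulmod_mx n f p) = (rVpoly v * p) %% f.
Proof.
move=> sf; have f0 : f != 0 by rewrite -size_poly_gt0 sf.
rewrite mulmx_sum_row linear_sum [in RHS]rVpolyE mulr_suml.
rewrite (big_morph (fun q => q %% f) (modpD _) (mod0p _)).
apply: eq_bigr => i _; rewrite linearZ /= -scalerAl modpZl; congr (_ *: _).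
rewrite -[RHS](@poly_rV_K _ n); last by rewrite -ltnS -sf ltn_modp.
by congr rVpoly; apply/rowP=> j; rewrite !mxE.
Qed.

Lemma mod_normM (E : fieldType) (f p q : {poly E}) : f != 0 ->
  mod_norm f (p * q) = mod_norm f p * mod_norm f q.
Proof.
move=> f0; have sf : size f = (size f).-1.+1 by rewrite prednK ?size_poly_gt0.
rewrite /mod_norm -det_mulmx; congr (\det _); apply/row_matrixP=> i.
apply: (can_inj rVpolyK); rewrite !rowE mulmxA !(@rVpoly_mulmod _ _ f) //.
by rewrite mulrA [X in _ = X %% _]mulrC modp_mul mulrC.
Qed.

Lemma mod_norm1 (E : fieldType) (f : {poly E}) : f != 0 -> mod_norm f 1 = 1.
Proof.
move=> f0; have sf : size f = (size f).-1.+1 by rewrite prednK ?size_poly_gt0.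
rewrite /mod_norm (_ : mulmod_mx _ _ _ = 1%:M) ?det1 //.
apply/row_matrixP=> i; apply: (can_inj rVpolyK).
rewrite !rowE (@rVpoly_mulmod _ _ f) // mulmx1 mulr1 modp_small //.
by rewrite [X in (_ < X)%N]sf ltnS size_rVpoly.
Qed.

Lemma mod_norm_modr (E : fieldType) (f p q : {poly E}) : p %% f = q %% f ->
  mod_norm f p = mod_norm f q.
Proof.
move=> e; congr (\det _); apply/matrixP=> i j; rewrite !mxE.
by rewrite -modp_mul e modp_mul.
Qed.

Lemma modp_dvdp (E : fieldType) (d n p : {poly E}) : d %| n ->
  (p %% n) %% d = p %% d.
Proof.
move=> dn; rewrite [p in RHS](divp_eq p n) modpD.
by rewrite [X in X + _]modp_eq0 ?add0r // dvdp_mull.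
Qed.

Lemma modp_mul2r (E : fieldType) (d n p : {poly E}) : d != 0 -> n != 0 ->
  (p * d) %% (n * d) = (p %% n) * d.
Proof.
move=> d0 n0; rewrite {1}(divp_eq p n) mulrDl -mulrA modpD modp_mull add0r.
have lt_r : (size (p %% n)%R < size n)%N by rewrite ltn_modp.
rewrite modp_small //; have [->|r0] := eqVneq (p %% n) 0.
  by rewrite mul0r size_poly0 size_poly_gt0 mulf_neq0.
rewrite !size_mul // -[size d]prednK ?size_poly_gt0 // !addnS /=.
by rewrite ltn_add2r.
Qed.

(** In the basis formed by the first powers of 'X followed by the multiples
    'X^i * l, multiplication by [p] modulo [l * h] is block triangular: the
    ideal generated by [l] is stable and isomorphic to E[X]/(h), and the
    quotient by it is E[X]/(l). *)
Lemma mod_norm_factor (E : fieldType) (l h p : {poly E}) : l != 0 -> h != 0 ->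
  mod_norm (l * h) p = mod_norm l p * mod_norm h p.
Proof.
move=> l0 h0; have lh0 : l * h != 0 by rewrite mulf_neq0.
have sl : size l = (size l).-1.+1 by rewrite prednK ?size_poly_gt0.
have sh : size h = (size h).-1.+1 by rewrite prednK ?size_poly_gt0.
rewrite /mod_norm.
have : (size (l * h)).-1 = ((size l).-1 + (size h).-1)%N.
  by rewrite size_mul // sl sh addnS.
move: (size l).-1 (size h).-1 sl sh => n1 n2 sl sh elh; rewrite elh.
have slh : size (l * h) = (n1 + n2).+1.
  by rewrite -elh prednK ?size_poly_gt0.
pose C1 : 'M[E]_(n1, n1 + n2) := \matrix_(i < n1) poly_rV 'X^i.
pose C2 : 'M[E]_(n2, n1 + n2) := \matrix_(i < n2) poly_rV ('X^i * l).
pose C := col_mx C1 C2.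
pose B : 'M[E]_(n1, n2) :=
  \matrix_(i < n1) poly_rV ((('X^i * p) %% (l * h)) %/ l).
have C1E (v : 'rV_n1) : rVpoly (v *m C1) = rVpoly v.
  rewrite mulmx_sum_row linear_sum [RHS]rVpolyE; apply: eq_bigr => i _.
  rewrite linearZ /= rowK poly_rV_K // size_polyXn.
  by rewrite (leq_trans (ltn_ord i)) // leq_addr.
have C2E (v : 'rV_n2) : rVpoly (v *m C2) = rVpoly v * l.
  rewrite mulmx_sum_row linear_sum rVpolyE mulr_suml; apply: eq_bigr => i _.
  rewrite linearZ /= rowK poly_rV_K ?scalerAl // mulrC size_mulXn // sl.
  by rewrite addnS -addSn addnC leq_add2l.
have CE : C *m mulmod_mx (n1 + n2) (l * h) p =
    block_mx (mulmod_mx n1 l p) B 0 (mulmod_mx n2 h p) *m C.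
  rewrite /C mul_block_col mul_col_mx mul0mx add0r.
  congr col_mx; apply/row_matrixP=> i; apply: (can_inj rVpolyK).
    rewrite !rowE !mulmxA (@rVpoly_mulmod _ _ (l * h)) // C1E rVpoly_delta.
    rewrite mulmxDr linearD /= !mulmxA C1E C2E (@rVpoly_mulmod _ _ l) //.
    rewrite rVpoly_delta -rowE rowK poly_rV_K; last first.
      rewrite size_divp // sl leq_subLR -ltnS.
      by rewrite (leq_trans (ltn_modpN0 _ lh0)) // slh.
    rewrite addrC [LHS](divp_eq _ l); congr (_ + _).
    by rewrite modp_dvdp ?dvdp_mulr.
  rewrite !rowE !mulmxA (@rVpoly_mulmod _ _ (l * h)) // C2E.
  rewrite C2E (@rVpoly_mulmod _ _ h) // rVpoly_delta.
  by rewrite mulrAC [l * h]mulrC modp_mul2r.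
(* C is triangular, with 1 and the leading coefficient of l on its diagonal. *)
have Cdet : \det C != 0.
  have C_trig : is_trig_mx C.
    apply/is_trig_mxP=> i j; rewrite /C mxE; case: splitP => k -> lt_ij.
      by rewrite !mxE coefXn gtn_eqF.
    rewrite !mxE coefXnM ltnNge (leq_trans (leq_addl n1 k) (ltnW lt_ij)) /=.
    by rewrite nth_default // sl ltn_subRL addnC.
  rewrite det_trig //; apply/prodf_neq0=> i _; rewrite /C mxE.
  case: splitP => k ek; rewrite !mxE ek.
    by rewrite coefXn eqxx oner_eq0.
  rewrite coefXnM ltnNge leq_addl /= addnK.
  by rewrite -[n1]/n1.+1.-1 -sl lead_coef_eq0.
apply: (mulfI Cdet); rewrite -det_mulmx CE det_mulmx det_ublock mulrC.
done.
Qed.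

Lemma mod_norm_prod_XsubC (E : fieldType) (r : seq E) (p : {poly E}) :
  mod_norm (\prod_(x <- r) ('X - x%:P)) p = \prod_(x <- r) p.[x].
Proof.
elim: r => [|x r IHr]; first by rewrite !big_nil /mod_norm size_poly1 det_mx00.
rewrite !big_cons mod_norm_factor ?polyXsubC_eq0 ?IHr //; last first.
  by rewrite prodf_seq_neq0; apply/allP=> y _; rewrite polyXsubC_eq0.
by rewrite /mod_norm size_XsubC /= det_mx11 mxE expr0 mul1r modp_XsubC coefC.
Qed.

(** Multiplication by 'X is given by the companion matrix of [h], whose
    characteristic polynomial is [h] up to a scalar; evaluate it at [a]. *)
Lemma mod_norm_XsubC (E : fieldType) (h : {poly E}) (a : E) : h != 0 ->
  mod_norm h ('X - a%:P) = (-1) ^+ (size h).-1 * (h.[a] / lead_coef h).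
Proof.
move=> h0; have lc0 : (lead_coef h)^-1 != 0 by rewrite invr_eq0 lead_coef_eq0.
pose k : {poly E} := (lead_coef h)^-1 *: h.
have k_monic : k \is monic by rewrite monicE lead_coefZ mulVf // lead_coef_eq0.
have sk : size k = size h by rewrite size_scale.
have -> : h.[a] / lead_coef h = k.[a] by rewrite hornerZ mulrC.
have -> : mod_norm h ('X - a%:P) =
    \det (mulmod_mx (size k).-1 k ('X - a%:P)).
  rewrite /mod_norm sk; congr (\det _); apply/matrixP=> i j.
  by rewrite !mxE modpZr.
have -> : k.[a] = \det (a%:M - companionmx k).
  rewrite -[in LHS](companionmxK k_monic) /char_poly -[LHS]/(horner_eval a _).
  rewrite -det_map_mx; congr (\det _); apply/matrixP=> i j.
  rewrite !mxE /= horner_evalE hornerD hornerN hornerC hornerMn.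
  by rewrite hornerX.
rewrite -sk -detZ scaleN1r opprB; congr (\det _); apply/matrixP=> i j.
rewrite !mxE mulrBr -exprSr modpD modpN coefB.
have lti : (i.+1 < size k)%N by rewrite -ltn_predRL.
have k_lc : k`_(size k).-1 = 1 by apply/eqP.
congr (_ - _); last first.
  rewrite -mulrC mul_polyC modpZl modp_small ?size_polyXn //.
  by rewrite coefZ coefXn eq_sym mulr_natr.
case: eqP => [ei|nei].
  have ei1 : i.+1 = (size k).-1.
    by rewrite ei prednK // (leq_ltn_trans _ (ltn_ord i)).
  have -> : 'X^(i.+1) %% k = 'X^(i.+1) - k.
    apply/esym/(@modpP _ _ 1); first by rewrite mul1r addrC subrK.
    apply: (@leq_ltn_trans i.+1); last by rewrite lti.
    apply/leq_sizeP=> m; rewrite leq_eqVlt coefB coefXn => /predU1P[<-|lt_im].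
      by rewrite eqxx ei1 k_lc subrr.
    rewrite gtn_eqF // nth_default ?subrr //.
    by rewrite -[size k]prednK ?size_poly_gt0 ?monic_neq0 // -ei1.
  by rewrite coefB coefXn ei1 ltn_eqF // sub0r.
rewrite modp_small ?size_polyXn ?coefXn 1?eq_sym //.
have aux m n : (m.+1 < n -> m <> n.-2 -> m.+2 < n)%N by lia.
exact: aux.
Qed.

(** By induction: a new root [a] multiplies the derivative at each earlier root
    x by x - a and contributes the value at [a] of the old polynomial, which is
    again the product of the x - a up to sign. *)
Lemma prod_deriv_roots (R : idomainType) (r : seq R) :
  exists d : R, \prod_(x <- r) (\prod_(y <- r) ('X - y%:P))^`().[x] =
    (-1) ^+ 'C(size r, 2) * d ^+ 2.
Proof.
elim: r => [|a r [d IHr]]; first by exists 1; rewrite big_nil expr1n mulr1.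
pose l := \prod_(y <- r) ('X - y%:P).
exists (l.[a] * d).
have -> : (\prod_(y <- a :: r) ('X - y%:P))^`() = l + ('X - a%:P) * l^`().
  by rewrite big_cons derivM derivXsubC mul1r.
rewrite big_cons hornerD hornerM hornerXsubC subrr mul0r addr0.
have -> : \prod_(x <- r) (l + ('X - a%:P) * l^`()).[x] =
    (-1) ^+ size r * l.[a] * \prod_(x <- r) l^`().[x].
  rewrite /l -[X in _ * X * _]/(horner_eval a _) rmorph_prod.
  have <- : \prod_(x <- r) (- 1 : R) = (-1) ^+ size r.
    by rewrite big_const_seq count_predT iter_mulr_1.
  rewrite -!big_split /=.
  apply: eq_big_seq => x xr; rewrite /horner_eval hornerD hornerM !hornerXsubC.
  have /eqP -> : root l x by rewrite root_prod_XsubC.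
  by rewrite add0r mulN1r opprB.
by rewrite IHr /= binS bin1 exprD; ring.
Qed.

(** * Sums over an ordered field *)

Lemma ordering_total (E : fieldType) (le : E -> E -> Prop) (x : E) :
  field_ordering le -> le 0 x \/ le 0 (- x).
Proof.
case=> _ _ tot addl _; case: (tot 0 x); [by left|move=> x_le0; right].
by have := addl _ _ (- x) x_le0; rewrite subrr add0r.
Qed.

Lemma ordering_mul (E : fieldType) (le : E -> E -> Prop) (x y : E) :
  field_ordering le -> le 0 x -> le 0 y -> le 0 (x * y).
Proof. by case=> _ _ _ _; apply. Qed.

Lemma ordering_sqr (E : fieldType) (le : E -> E -> Prop) (x : E) :
  field_ordering le -> le 0 (x ^+ 2).
Proof.
move=> le_ord; rewrite expr2; case: (ordering_total x le_ord) => x0.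
  exact: ordering_mul.
by rewrite -mulrNN; apply: ordering_mul.
Qed.

Lemma ordering_add (E : fieldType) (le : E -> E -> Prop) (x y : E) :
  field_ordering le -> le 0 x -> le 0 y -> le 0 (x + y).
Proof.
case=> _ tr _ addl _ x0 y0; apply: tr y0 _.
by have := addl _ _ y x0; rewrite add0r.
Qed.

Lemma ordering_addr_eq0 (E : fieldType) (le : E -> E -> Prop) (x y : E) :
  field_ordering le -> le 0 x -> le 0 y -> x + y = 0 -> x = 0 /\ y = 0.
Proof.
case=> asym _ _ addl _ x0 y0 xy0.
have x_eq0 : x = 0.
  by apply: asym x0; have := addl _ _ x y0; rewrite add0r addrC xy0.
by split=> //; rewrite x_eq0 add0r in xy0.
Qed.

Lemma ordering_sum (E : fieldType) (le : E -> E -> Prop) (T : eqType)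
    (r : seq T) (F : T -> E) :
  field_ordering le -> {in r, forall x, le 0 (F x)} -> le 0 (\sum_(x <- r) F x).
Proof.
move=> le_ord Fpos; rewrite big_seq; elim/big_ind: _ => //.
  by have := ordering_sqr 0 le_ord; rewrite expr0n.
by move=> x y; apply: ordering_add.
Qed.

Lemma ordering_sum_eq0 (E : fieldType) (le : E -> E -> Prop) (T : eqType)
    (r : seq T) (F : T -> E) :
  field_ordering le -> {in r, forall x, le 0 (F x)} ->
  \sum_(x <- r) F x = 0 -> {in r, forall x, F x = 0}.
Proof.
move=> le_ord; elim: r => // x r IHr Fpos; rewrite big_cons => sum0.
have Fr : {in r, forall y, le 0 (F y)}.
  by move=> y yr; apply: Fpos; rewrite inE yr orbT.
have [] := ordering_addr_eq0 le_ord _ _ sum0; first exact/Fpos/mem_head.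
  exact: ordering_sum.
by move=> Fx0 /(IHr Fr) Fr0 y; rewrite inE => /predU1P[->|/Fr0].
Qed.

Lemma real_sum_sqr_eq0 (E : fieldType) (T : eqType) (r : seq T) (F : T -> E) :
  real_field E -> \sum_(x <- r) F x ^+ 2 = 0 -> {in r, forall x, F x = 0}.
Proof.
case=> le le_ord sum0 x xr; apply/eqP; rewrite -sqrf_eq0; apply/eqP.
by apply: (ordering_sum_eq0 le_ord _ sum0) xr => y _; apply: ordering_sqr.
Qed.

(** Some term of a vanishing sum is positive for the ordering; only the
    definiteness of the binary form <1, F x> that results from this is kept,
    since it no longer mentions the ordering. *)
Lemma real_sum_eq0_definite (E : fieldType) (T : eqType) (r : seq T)
    (F : T -> E) : real_field E -> r != [::] ->
    {in r, forall x, F x != 0} -> \sum_(x <- r) F x = 0 ->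
  exists2 x, x \in r & forall y z, y ^+ 2 + F x * z ^+ 2 = 0 -> y = 0 /\ z = 0.
Proof.
case=> le le_ord r_neq0 F_neq0 sum0.
suff [x xr Fx] : exists2 x, x \in r & le 0 (F x).
  exists x => // y z yz0; have /(_ _)[] := ordering_addr_eq0 le_ord _ _ yz0.
  - exact: ordering_sqr.
  - by apply: ordering_mul => //; apply: ordering_sqr.
  move=> /eqP; rewrite sqrf_eq0 => /eqP -> /eqP.
  by rewrite mulf_eq0 (negPf (F_neq0 x xr)) sqrf_eq0 => /eqP.
have [//|NF] : (exists2 x, x \in r & le 0 (F x)) \/
    {in r, forall x, le 0 (- F x)}.
  elim: (r) => [|a r' [[x xr Fx]|NF]]; first by right.
    by left; exists x; rewrite // inE xr orbT.
  case: (ordering_total (F a) le_ord) => Fa.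
    by left; exists a; rewrite ?mem_head.
  by right=> x; rewrite inE => /predU1P[->|/NF].
have NF0 := ordering_sum_eq0 le_ord NF.
case: r r_neq0 F_neq0 sum0 NF NF0 => // a r' _ F_neq0 sum0 _ NF0.
have sumN : \sum_(x <- a :: r') - F x = 0 by rewrite sumrN sum0 oppr0.
have /eqP := NF0 sumN a (mem_head a r').
by rewrite oppr_eq0 (negPf (F_neq0 a (mem_head a r'))).
Qed.

(** * Lagrange interpolation *)

Lemma deriv_root_prod_XsubC (F : fieldType) (r : seq F) (x : F) :
  uniq r -> x \in r ->
  (\prod_(y <- r) ('X - y%:P))^`().[x] = (\prod_(y <- rem x r) ('X - y%:P)).[x]
  /\ (\prod_(y <- r) ('X - y%:P))^`().[x] != 0.
Proof.
move=> r_uniq xr; have -> : (\prod_(y <- r) ('X - y%:P))^`().[x] =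
    (\prod_(y <- rem x r) ('X - y%:P)).[x].
  rewrite (big_rem x xr) /= derivM derivXsubC mul1r hornerD hornerM.
  by rewrite hornerXsubC subrr mul0r addr0.
split=> //; rewrite -[_ == 0]/(root _ x) root_prod_XsubC.
by rewrite mem_rem_uniq // inE eqxx.
Qed.

(** The sum is the coefficient of degree [size r - 1] in the Lagrange
    interpolation of [q] at the entries of [r], and this interpolation is [q]
    itself. *)
Lemma sum_horner_div_deriv (F : fieldType) (r : seq F) (q : {poly F}) :
  uniq r -> (size q < size r)%N ->
  \sum_(x <- r) q.[x] / (\prod_(y <- r) ('X - y%:P))^`().[x] = 0.
Proof.
move=> r_uniq lt_q; set l' := _^`().
pose L x := \prod_(y <- rem x r) ('X - y%:P).
pose p := \sum_(x <- r) (q.[x] / l'.[x]) *: L x.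
have sL x : x \in r -> size (L x) = size r.
  move=> xr; rewrite size_prod_XsubC size_rem // prednK //.
  by case: (r) xr.
have size_p : (size p <= size r)%N.
  rewrite /p big_seq; apply: (leq_trans (size_sum _ _ _)).
  apply/bigmax_leqP_seq => x _ xr.
  by rewrite (leq_trans (size_scale_leq _ _)) // sL.
have pq : p = q.
  apply/eqP; rewrite -subr_eq0; apply/eqP.
  apply: (@roots_geq_poly_eq0 _ _ r) => //; last first.
    by rewrite (leq_trans (size_polyD _ _)) // geq_max size_p size_polyN ltnW.
  apply/allP=> x xr; rewrite rootE hornerD hornerN subr_eq0 horner_sum.
  have [dE d0] := deriv_root_prod_XsubC r_uniq xr.
  rewrite (bigD1_seq x) //= big1_seq ?addr0; last first.
    move=> y /andP[yx yr]; rewrite hornerZ.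
    have /eqP -> : root (L y) x.
      by rewrite root_prod_XsubC mem_rem_uniq // inE eq_sym yx.
    by rewrite mulr0.
  by rewrite hornerZ /L -dE divfK.
transitivity p`_(size r).-1; last first.
  by rewrite pq nth_default // -ltnS prednK // (leq_ltn_trans _ lt_q).
rewrite coef_sum; apply: eq_big_seq => x xr.
rewrite coefZ -(sL x xr) -[(L x)`_ _]/(lead_coef (L x)).
by rewrite (eqP (monic_prod_XsubC _ _ _)) mulr1.
Qed.

(** * Small solutions and descent *)

Lemma linear_kernel_neq0 (K : fieldType) (aT rT : vectType K)
    (phi : {linear aT -> rT}) :
  (dim rT < dim aT)%N -> exists2 x, x != 0 & phi x = 0.
Proof.
move=> lt_dim; exists (vpick (lker (linfun phi))); last first.
  by have := memv_pick (lker (linfun phi)); rewrite memv_ker lfunE => /eqP.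
rewrite vpick0; apply: contraTneq lt_dim => ker0; rewrite -leqNgt.
have := limg_ker_dim (linfun phi) fullv; rewrite ker0 capv0 dimv0 add0n dimvf.
by move=> <-; rewrite -[X in (_ <= X)%N]dimvf dimvS ?subvf.
Qed.

(** Thue's pigeonhole argument: the two congruences impose deg g + deg h linear
    conditions on the coefficients of [v], [t] and [z]. *)
Lemma small_solution (E : fieldType) (g h u w : {poly E}) (N1 N2 N3 : nat) :
  g != 0 -> h != 0 ->
  ((size g).-1 + (size h).-1 < N1 + N2 + N3)%N ->
  exists v t z : {poly E},
    [/\ [/\ (size v <= N1)%N, (size t <= N2)%N & (size z <= N3)%N],
        [|| v != 0, t != 0 | z != 0], g %| v - u * z & h %| v - w * t].
Proof.
move=> g0 h0 lt_dim.
pose aT : vectType E := ({poly_N1 E} * {poly_N2 E} * {poly_N3 E})%type.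
pose rT : vectType E := (polymod g * polymod h)%type.
pose phi (x : aT) : rT :=
  (polymod_class g (polyn x.1.1 - u * polyn x.2),
   polymod_class h (polyn x.1.1 - w * polyn x.1.2)).
have phi_lin : linear phi.
  move=> a x y; rewrite /phi /=.
  have -> c : polyn (a *: x.1.1 + y.1.1) - c * polyn (a *: x.2 + y.2) =
      a *: (polyn x.1.1 - c * polyn x.2) + (polyn y.1.1 - c * polyn y.2).
    by rewrite /= scalerBr mulrDr -scalerAr opprD addrACA.
  have -> c : polyn (a *: x.1.1 + y.1.1) - c * polyn (a *: x.1.2 + y.1.2) =
      a *: (polyn x.1.1 - c * polyn x.1.2) + (polyn y.1.1 - c * polyn y.1.2).
    by rewrite /= scalerBr mulrDr -scalerAr opprD addrACA.
  by rewrite !linearP.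
pose phiL : {linear aT -> rT} :=
  HB.pack phi (GRing.isLinear.Build _ _ _ _ phi phi_lin).
have [//|[[v t] z] xn0 [eqg eqh]] := @linear_kernel_neq0 _ _ _ phiL.
exists v, t, z; split.
- by split; apply: size_npoly.
- apply: contraNT xn0; rewrite !negb_or !negbK.
  move=> /and3P[/eqP v0 /eqP t0 /eqP z0].
  by apply/eqP; congr (_, _, _); apply: val_inj.
- by move: eqg; rewrite -(linear0 (polymod_class g)) polymod_class_eq // subr0.
- by move: eqh; rewrite -(linear0 (polymod_class h)) polymod_class_eq // subr0.
Qed.

Lemma dvdp_XsubC_sqr (F : fieldType) (k v : {poly F}) (a : F) : k.[a] != 0 ->
  ('X - a%:P) ^+ 2 %| ('X - a%:P) * k * v ^+ 2 -> 'X - a%:P %| v.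
Proof.
move=> ka; rewrite expr2 -mulrA dvdp_mul2l ?polyXsubC_eq0 // Gauss_dvdpr.
  by rewrite !dvdp_XsubCl rootE horner_exp sqrf_eq0.
by rewrite coprimep_sym coprimep_XsubC.
Qed.

(** Infinite descent at [a]: the binary form with coefficients g(a) and h(a) is
    anisotropic, so [t] and [z] vanish at [a]. The right-hand side is then
    divisible by the square of 'X - a, whereas 'X - a divides the coefficient of
    [v ^+ 2] exactly once, so [v] vanishes at [a] as well and the square of
    'X - a can be cancelled. *)
Lemma anisotropic_descent (F : fieldType) (a : F) (k g h : {poly F}) :
  k.[a] != 0 ->
  (forall y z : F, g.[a] * y ^+ 2 + h.[a] * z ^+ 2 = 0 -> y = 0 /\ z = 0) ->
  forall v t z : {poly F},
    ('X - a%:P) * k * v ^+ 2 = g * t ^+ 2 + h * z ^+ 2 -> t = 0 /\ z = 0.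
Proof.
move=> ka gh v t z; have X0 : 'X - a%:P != 0 by rewrite polyXsubC_eq0.
have [n] := ubnP (size t + size z)%N.
elim: n v t z => // n IHn v t z lt_n eq_vtz.
have [|/eqP t_a /eqP z_a] := gh t.[a] z.[a].
  have := congr1 (horner^~ a) eq_vtz.
  by rewrite /= !(hornerXsubC, hornerD, hornerM, horner_exp) subrr !mul0r.
have {t_a} /dvdpP[t1 t1E] : 'X - a%:P %| t by rewrite dvdp_XsubCl.
have {z_a} /dvdpP[z1 z1E] : 'X - a%:P %| z by rewrite dvdp_XsubCl.
have /dvdpP[v1 v1E] : 'X - a%:P %| v.
  apply: (dvdp_XsubC_sqr ka); rewrite eq_vtz t1E z1E.
  by apply/dvdpP; exists (g * t1 ^+ 2 + h * z1 ^+ 2); ring.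
have eq1 : ('X - a%:P) * k * v1 ^+ 2 = g * t1 ^+ 2 + h * z1 ^+ 2.
  apply: (mulIf (expf_neq0 2 X0)); move: eq_vtz; rewrite t1E z1E v1E.
  by move=> e; transitivity (('X - a%:P) * k * (v1 * ('X - a%:P)) ^+ 2);
    [ring|rewrite e; ring].
have sz p : p != 0 -> size (p * ('X - a%:P)) = (size p).+1.
  by move=> p0; rewrite size_mul ?polyXsubC_eq0 // size_XsubC addn2.
have [t10|t10] := eqVneq t1 0; have [z10|z10] := eqVneq z1 0.
- by rewrite t1E z1E t10 z10 !mul0r.
all: have [|t1_0 z1_0] := IHn _ _ _ _ eq1;
  last by rewrite t1E z1E t1_0 z1_0 !mul0r.
all: rewrite -ltnS; apply: leq_ltn_trans lt_n; rewrite t1E z1E.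
- by rewrite t10 mul0r sz // addnS.
- by rewrite z10 mul0r sz // addSn.
- by rewrite !sz // addSn addnS ltnS leqnSn.
Qed.

(** * The obstruction *)

Lemma size_sqr_half (R : idomainType) (p : {poly R}) (N : nat) :
  (size p <= N./2)%N -> (size (p ^+ 2)%R <= N.-1)%N.
Proof.
have [->|p0] := eqVneq p 0; first by rewrite expr0n size_poly0.
by rewrite expr2 size_mul //; move: p0; rewrite -size_poly_gt0; lia.
Qed.

(** The polynomial [g] would be a square times l + l' h modulo [l * h], while
    [l * h] would be a square modulo [g]. Then the form
    v^2 - g l t^2 - l h z^2 is divisible by [g] when v = u z modulo [g] and by
    [h] when v = s l t modulo [h]. When v^2, g l t^2 and l h z^2 all have degree
    at most deg g + deg (l h) - 2, the quotient by [g * h] has degree less than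
    [size r - 1], while its values at the roots of [l], weighted by 1 / l', are
    squares with sum zero: it vanishes. So does the form, [l] divides [v], and
    what remains is impossible by descent at a root where l' is positive. *)
Lemma no_mutually_square_pair (E : fieldType) (r : seq E) (h g s u : {poly E}) :
  let l := \prod_(x <- r) ('X - x%:P) in
  real_field E -> uniq r -> (3 < size r)%N -> h != 0 -> g != 0 ->
  coprimep g (l * h) ->
  l * h %| g - (l + l^`() * h) * s ^+ 2 ->
  g %| l * h - u ^+ 2 ->
  False.
Proof.
(* In these bounds k, m and e are the degrees of l, g and h. In the first one
   at k = 4, at most two of the three halves are rounded down, so their sum is
   at least e + m + k / 2 - 1; at k = 3 with e and m odd it would fail. *)
have bound_dim k m e : (3 < k -> m + e < (e + k + m)./2 + e./2 + m./2)%N by lia.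
have bound_z k m e n : (0 < n -> n <= m.-1 ->
  (((k.+1 + e.+1).-1 + n).-1 <= (e + k + m).-1))%N by lia.
have bound_t k m e n : (0 < n -> n <= e.-1 ->
  (((m.+1 + k.+1).-1 + n).-1 <= (e + k + m).-1))%N by lia.
have bound_q k m e n : (0 < n ->
  ((m.+1 + e.+1).-1 + n).-1 <= (e + k + m).-1 -> n < k)%N by lia.
have size_mul3 (p q w : {poly E}) : p != 0 -> q != 0 -> w != 0 ->
    size (p * q * w) = ((size p + size q).-1 + size w).-1.
  by move=> p0 q0 w0; rewrite !size_mul ?mulf_neq0.
move=> l hE r_uniq lt3r h0 g0; rewrite coprimepMr => /andP[co_gl co_gh].
move=> /dvdpP[c gE] /dvdpP[d fE].
have l_monic : l \is monic by apply: monic_prod_XsubC.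
have l0 : l != 0 by apply: monic_neq0.
have root_l x : root l x = (x \in r) by apply: root_prod_XsubC.
have g_root x : x \in r -> g.[x] = l^`().[x] * h.[x] * s.[x] ^+ 2.
  rewrite -root_l => /rootP lx.
  have /(congr1 (horner^~ x)) := gE.
  rewrite /= !(hornerD, hornerN, hornerM, horner_exp) lx.
  rewrite mul0r mulr0 add0r.
  by move/eqP; rewrite subr_eq0 => /eqP.
have g_root_neq0 x : x \in r -> g.[x] != 0.
  by rewrite -root_l; apply: coprimep_root; rewrite coprimep_sym.
have l'_neq0 x : x \in r -> l^`().[x] != 0.
  by move=> xr; case: (deriv_root_prod_XsubC r_uniq xr).
have h_root_neq0 x : x \in r -> h.[x] != 0.
  move=> xr; apply: contraNneq (g_root_neq0 x xr) => hx.
  by rewrite g_root // hx mulr0 mul0r.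
have s_root_neq0 x : x \in r -> s.[x] != 0.
  move=> xr; apply: contraNneq (g_root_neq0 x xr) => sx.
  by rewrite g_root // sx expr0n mulr0.
have sl : size l = (size r).+1 by rewrite size_prod_XsubC.
set k := size r in lt3r sl; pose m := (size g).-1; pose e := (size h).-1.
have sg : size g = m.+1 by rewrite prednK // size_poly_gt0.
have sh : size h = e.+1 by rewrite prednK // size_poly_gt0.
have [|v [t [z [[sv st sz] vtz0 /dvdpP[A vA] /dvdpP[B vB]]]]] :=
  @small_solution _ g h u (s * l) (e + k + m)./2 e./2 m./2 g0 h0.
  exact: bound_dim.
pose D := v ^+ 2 - g * l * t ^+ 2 - l * h * z ^+ 2.
have gD : g %| D.
  apply/dvdpP; exists (A * (v + u * z) - l * t ^+ 2 - d * z ^+ 2).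
  transitivity ((v - u * z) * (v + u * z) - g * l * t ^+ 2
                - (l * h - u ^+ 2) * z ^+ 2); first by rewrite /D; ring.
  by rewrite vA fE; ring.
have hD : h %| D.
  apply/dvdpP.
  exists (B * (v + s * l * t) - l * (c * l + l^`() * s ^+ 2) * t ^+ 2
          - l * z ^+ 2).
  transitivity ((v - s * l * t) * (v + s * l * t)
       - (g - (l + l^`() * h) * s ^+ 2) * l * t ^+ 2
       - l^`() * h * s ^+ 2 * l * t ^+ 2 - l * h * z ^+ 2).
    by rewrite /D; ring.
  by rewrite vB gE; ring.
have D_root x : x \in r -> D.[x] = v.[x] ^+ 2.
  rewrite -root_l => /rootP lx.
  rewrite /D !(horner_exp, hornerD, hornerN, hornerM) lx.
  by rewrite mulr0 !mul0r !subr0.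
have D0 : D = 0.
  have /dvdpP[q qE] : g * h %| D by rewrite Gauss_dvdp ?gD.
  apply/eqP; apply/negPn/negP => Dn0.
  have q0 : q != 0 by apply: contraNneq Dn0 => q0; rewrite qE q0 mul0r.
  have sv2 := size_sqr_half sv.
  have sz2 : (size (l * h * z ^+ 2)%R <= (e + k + m).-1)%N.
    have [->|zn0] := eqVneq z 0; first by rewrite expr0n mulr0 size_poly0.
    rewrite size_mul3 ?expf_neq0 // sl sh; apply: bound_z (size_sqr_half sz).
    by rewrite size_poly_gt0 expf_neq0.
  have st2 : (size (g * l * t ^+ 2)%R <= (e + k + m).-1)%N.
    have [->|tn0] := eqVneq t 0; first by rewrite expr0n mulr0 size_poly0.
    rewrite size_mul3 ?expf_neq0 // sl sg; apply: bound_t (size_sqr_half st).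
    by rewrite size_poly_gt0 expf_neq0.
  have sD : (size D <= (e + k + m).-1)%N.
    rewrite /D (leq_trans (size_polyD _ _)) // geq_max size_polyN sz2 andbT.
    by rewrite (leq_trans (size_polyD _ _)) // geq_max size_polyN sv2.
  have sq : (size q < k)%N.
    move: sD; rewrite qE mulrC size_mul3 // sg sh.
    by apply: bound_q; rewrite size_poly_gt0.
  (* This is v(x)^2 / (g h l')(x), and g(x) is h(x) l'(x) times a square. *)
  have q_root x : x \in r ->
      q.[x] / l^`().[x] = (v.[x] / (h.[x] * l^`().[x] * s.[x])) ^+ 2.
    move=> xr; have := D_root x xr; rewrite qE !hornerM.
    rewrite expr_div_n => <-; rewrite g_root //.
    by field; rewrite l'_neq0 ?h_root_neq0 ?s_root_neq0.
  have sum0 := sum_horner_div_deriv r_uniq sq.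
  rewrite (eq_big_seq _ q_root) in sum0.
  have v0 := real_sum_sqr_eq0 hE sum0.
  case/eqP: q0; apply: (@roots_geq_poly_eq0 _ _ r) => //; last exact: ltnW.
  apply/allP=> x xr; rewrite rootE; have := q_root x xr; rewrite v0 // expr0n.
  by move/eqP; rewrite mulf_eq0 invr_eq0 (negPf (l'_neq0 x xr)) orbF.
have /dvdpP[w wE] : l %| v.
  apply: uniq_roots_dvdp; last by rewrite uniq_rootsE.
  by apply/allP=> x xr; rewrite rootE -sqrf_eq0 -D_root // D0 horner0.
have eq_w : l * w ^+ 2 = g * t ^+ 2 + h * z ^+ 2.
  apply: (mulfI l0); apply/eqP; rewrite -subr_eq0; apply/eqP.
  by rewrite -D0 /D wE; ring.
(* The 1 / l'(x) have sum zero: interpolate the constant 1. *)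
have [|||x xr x_def] :=
  @real_sum_eq0_definite _ _ r (fun x => (l^`().[x])^-1) hE.
- by apply: contraTneq lt3r => r0; rewrite /k r0.
- by move=> x xr; rewrite invr_eq0 l'_neq0.
- have := @sum_horner_div_deriv _ r 1 r_uniq; rewrite size_poly1 -/l.
  move=> /(_ (ltn_trans (isT : 1 < 3)%N lt3r)) {2}<-.
  by apply: eq_bigr => x _; rewrite hornerC div1r.
have lE : l = ('X - x%:P) * \prod_(y <- rem x r) ('X - y%:P).
  by rewrite /l (big_rem x xr).
have [k_x kx0] := deriv_root_prod_XsubC r_uniq xr.
rewrite k_x in kx0; rewrite lE in eq_w.
have [|t0 z0] := anisotropic_descent kx0 _ eq_w.
  move=> y z1 yz0; have [|z10 /eqP] := x_def z1 (l^`().[x] * s.[x] * y).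
    apply: (mulfI (h_root_neq0 x xr)); rewrite mulr0 -yz0 g_root //.
    by field; rewrite l'_neq0.
  rewrite !mulf_eq0 (negPf (l'_neq0 x xr)) (negPf (s_root_neq0 x xr)).
  by move=> /eqP.
move: vtz0 D0; rewrite /D t0 z0 eqxx !orbF expr0n !mulr0 !subr0 => v0 /eqP.
by rewrite sqrf_eq0 (negPf v0).
Qed.

(** * A unit of square norm *)

Lemma coprimep_prod_XsubC (F : fieldType) (r : seq F) (p : {poly F}) :
  {in r, forall x, p.[x] != 0} -> coprimep p (\prod_(x <- r) ('X - x%:P)).
Proof.
elim: r => [|a r IHr] pr; first by rewrite big_nil coprimep1.
rewrite big_cons coprimepMr coprimep_XsubC rootE pr ?mem_head //=.
by apply: IHr => x xr; apply: pr; rewrite inE xr orbT.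
Qed.

Lemma is_unit_polymod_class (E : fieldType) (f p : {poly E}) : f != 0 ->
  coprimep p f -> is_unit (polymod_class f p).
Proof.
move=> f0 /Bezout_eq1_coprimepP[[u v] /= uv]; exists (polymod_class f u).
rewrite -rmorphM -(rmorph1 (polymod_class f)); apply/polymod_class_eq => //.
by rewrite -uv mulrC opprD addNKr dvdpNr dvdp_mull.
Qed.

Lemma square_free_simple_roots (E : fieldType) (h : {poly E}) (r : seq E)
    (x : E) :
  square_free (h * \prod_(y <- r) ('X - y%:P)) -> x \in r -> h.[x] != 0.
Proof.
move=> sf xr; apply/negP; rewrite -[_ == 0]/(root h x) -dvdp_XsubCl.
move=> /dvdpP[k hE].
apply: (sf ('X - x%:P) (k * \prod_(y <- rem x r) ('X - y%:P))).
  case=> y xy1; have : 'X - x%:P %| 1.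
    by apply/dvdpP; exists y; rewrite mulrC xy1.
  by rewrite dvdp1 size_XsubC.
by rewrite hE (big_rem x xr) /=; ring.
Qed.

(** By multiplicativity the norm is the product of the values of l' h at the
    roots of [l] and of the norm of [l] modulo [h]. The latter is, up to a
    fourth power, the product of the values of [h] at the same roots, and the
    values of l' multiply to a square, the sign of [prod_deriv_roots] being +1
    for four roots. *)
Lemma mod_norm_unit_square (E : fieldType) (r : seq E) (h : {poly E}) :
  let l := \prod_(x <- r) ('X - x%:P) in
  uniq r -> size r = 4%N -> {in r, forall x, h.[x] != 0} -> h != 0 ->
  exists2 c, c != 0 & mod_norm (l * h) (l + l^`() * h) = c ^+ 2.
Proof.
move=> l r_uniq r4 h_root h0.
have l0 : l != 0 by apply/monic_neq0/monic_prod_XsubC.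
have [d dE] := prod_deriv_roots r.
pose b := (-1) ^+ (size h).-1 / lead_coef h.
have b0 : b != 0 by rewrite mulf_neq0 ?invr_eq0 ?lead_coef_eq0 ?signr_eq0.
pose H := \prod_(x <- r) h.[x].
have H0 : H != 0 by rewrite prodf_seq_neq0; apply/allP=> x /h_root.
have norm_h : mod_norm h (l + l^`() * h) = b ^+ size r * H.
  rewrite (@mod_norm_modr _ _ _ l) ?modpD ?modp_mull ?addr0 // /l /H.
  elim: (r) => [|x r' IHr']; first by rewrite !big_nil mod_norm1 // mulr1.
  by rewrite !big_cons mod_normM // IHr' mod_norm_XsubC // exprS /b; ring.
have norm_l : mod_norm l (l + l^`() * h) = d ^+ 2 * H.
  rewrite mod_norm_prod_XsubC.
  have -> : d ^+ 2 = \prod_(x <- r) l^`().[x].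
    by rewrite dE r4 -signr_odd mul1r.
  rewrite -big_split; apply: eq_big_seq => x /= xr.
  have /eqP lx : root l x by rewrite root_prod_XsubC.
  by rewrite hornerD hornerM lx add0r.
exists (d * H * b ^+ 2); last first.
  by rewrite mod_norm_factor // norm_l norm_h r4; ring.
have d0 : d != 0.
  rewrite -sqrf_eq0 (_ : d ^+ 2 = \prod_(x <- r) l^`().[x]); last first.
    by rewrite dE r4 -signr_odd mul1r.
  rewrite prodf_seq_neq0; apply/allP=> x xr.
  by case: (deriv_root_prod_XsubC r_uniq xr).
by apply: mulf_neq0; [apply: mulf_neq0|apply: expf_neq0].
Qed.

Unset Implicit Arguments.

Theorem proposition4p3 (E : fieldType) (hE : real_field E) (f : {poly E})
    (hf : square_reflexive f) (s : seq E) (s_uniq : uniq s)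
    (s_root : all (root f) s) :
  (size s <= 3)%N.
Proof.
have [f0 f_sf f_refl] := hf; rewrite leqNgt; apply/negP=> s_gt3.
pose r := take 4 s; have r4 : size r = 4%N by rewrite size_takel.
have r_uniq : uniq r by rewrite take_uniq.
have r_root : all (root f) r.
  by apply/allP=> x /mem_take; apply: (allP s_root).
pose l := \prod_(x <- r) ('X - x%:P).
have /dvdpP[h fE] : l %| f by apply: uniq_roots_dvdp; rewrite ?uniq_rootsE.
have h0 : h != 0 by apply: contraNneq f0 => h0; rewrite fE h0 mul0r.
have h_root : {in r, forall x, h.[x] != 0}.
  by move=> x; apply: square_free_simple_roots; rewrite -fE.
rewrite mulrC in fE; pose p := l + l^`() * h.
have co_hl : coprimep h l by apply: coprimep_prod_XsubC.
have co_pl : coprimep p l.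
  apply: coprimep_prod_XsubC => x xr.
  have [_ l'x] := deriv_root_prod_XsubC r_uniq xr.
  have /eqP lx : root l x by rewrite root_prod_XsubC.
  by rewrite hornerD hornerM lx add0r mulf_neq0 ?h_root.
have co_pf : coprimep p f.
  rewrite fE coprimepMr co_pl -coprimep_modl modpD modp_mull addr0.
  by rewrite coprimep_modl coprimep_sym.
have [c c0 norm_p] := mod_norm_unit_square r_uniq r4 h_root h0.
have [||g [g0 co_gf [y [u _ ->] gE] [w _ fgE]]] := f_refl (polymod_class f p).
- exact: is_unit_polymod_class.
- left; exists c; first by exists c^-1; rewrite divff.
  by rewrite polymod_norm_class // fE norm_p.
apply: (@no_mutually_square_pair _ r h g (polymod_repr u) (polymod_repr w));
  rewrite -?fE //.
- by rewrite r4.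
- apply/polymod_class_eq => //.
  by rewrite rmorphM rmorphXn /= polymod_reprK.
- exact/polymod_class_eq.
Qed.
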